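(* For all integers $m,n\ge 1$, the independence polynomial $I_{T_{3,m,n}}(t)$ of the tree $T_{3,m,n}$ is unimodal.
   Context: For a finite simple graph $G$, let $i_k$ be the number of independent (stable) sets of $G$ of size $k$ ($i_0=1$), and $\alpha(G)$ the maximum size of an independent set. The independence polynomial is $I_G(t)=\sum_{k=0}^{\alpha(G)} i_k t^k$. A sequence $a_0,\dots,a_N$ is unimodal if there is $j$ with $a_0\le a_1\le\cdots\le a_j\ge a_{j+1}\ge\cdots\ge a_N$; a polynomial is unimodal if its coefficient sequence is. For nonnegative integers $m,n$, the tree $T_{3,m,n}$ has a root $v_0$ with three children $v_1,v_2,v_3$; $v_1$ has three children $v_{11},v_{12},v_{13}$, $v_2$ has $m$ children $v_{21},\dots,v_{2m}$, $v_3$ has $n$ children $v_{31},\dots,v_{3n}$, and each $v_{ij}$ has exactly one further child $v'_{ij}$ (a leaf). (Equivalently: $v_0$ joined to the centers of three spiders with $3$, $m$, $n$ legs of length $2$.) *)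

(* Defs.v *)
From mathcomp Require Import all_boot.
Set Implicit Arguments. Unset Strict Implicit. Unset Printing Implicit Defensive.

(* A simple graph on a finite vertex type T is given by an adjacency relation
   [adj : rel T] (symmetric and irreflexive for the trees below). *)
Section Indep.
Variables (T : finType) (adj : rel T).

Definition independent (S : {set T}) : bool :=
  [forall x in S, forall y in S, ~~ adj x y].

Definition indep_count (k : nat) : nat :=
  #|[set S : {set T} | independent S & #|S| == k]|.

Definition indep_number : nat := \max_(S : {set T} | independent S) #|S|.

Definition indep_poly_coefs : seq nat :=
  [seq indep_count k | k <- iota 0 indep_number.+1].
End Indep.

Definition unimodal (s : seq nat) : Prop :=
  exists j, (forall i, i < j -> i.+1 < size s -> nth 0 s i <= nth 0 s i.+1) /\
            (forall i, j <= i -> i.+1 < size s -> nth 0 s i.+1 <= nth 0 s i).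

(* Vertex set:  v0                          = inl (inl (inl (inl tt)))
                v1, v2, v3 (i = 0,1,2)      = inl (inl (inl (inr i)))
                v_{1j} / v'_{1j}  (j < 3)   = inl (inl (inr (j, false/true)))
                v_{2j} / v'_{2j}  (j < m)   = inl (inr (j, false/true))
                v_{3j} / v'_{3j}  (j < n)   = inr (j, false/true)        *)
Definition tvert (m n : nat) : finType :=
  ((((unit + 'I_3) + ('I_3 * bool)) + ('I_m * bool)) + ('I_n * bool))%type.

Definition c0 : 'I_3 := @Ordinal 3 0 isT.
Definition c1 : 'I_3 := @Ordinal 3 1 isT.
Definition c2 : 'I_3 := @Ordinal 3 2 isT.

Definition tparent (m n : nat) (x : tvert m n) : option (tvert m n) :=
  match x with
  | inl (inl (inl (inl _))) => None
  | inl (inl (inl (inr _))) => Some (inl (inl (inl (inl tt))))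
  | inl (inl (inr (j, false))) => Some (inl (inl (inl (inr c0))))
  | inl (inl (inr (j, true))) => Some (inl (inl (inr (j, false))))
  | inl (inr (j, false)) => Some (inl (inl (inl (inr c1))))
  | inl (inr (j, true)) => Some (inl (inr (j, false)))
  | inr (j, false) => Some (inl (inl (inl (inr c2))))
  | inr (j, true) => Some (inr (j, false))
  end.

Definition tadj (m n : nat) : rel (tvert m n) :=
  fun x y => (tparent x == Some y) || (tparent y == Some x).

(* Main.v *)
Require Import Defs.
From Stdlib Require Import NArith.
From mathcomp Require Import all_boot all_order all_algebra.
From mathcomp Require Import zify ring.
Import Order.TTheory GRing.Theory Num.Theory.
Set Implicit Arguments. Unset Strict Implicit. Unset Printing Implicit Defensive.

(** With a = 1 + 2t, b = 1 + t and N = m + n + 3, conditioning on the states of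
    v0, v1, v2, v3 gives
      I = (a^3 + t b^3) (a^m + t b^m) (a^n + t b^n) + t a^N
        = (1 + t) a^N + (seven terms t^l a^i b^j, 1 <= l <= 3, i + j = N).
    Because 2b = a + 1, each a^i b^j is an average of powers a^p with p <= N,
    so it suffices to estimate the first and second differences of the explicit
    coefficients 2^k C(p, k).  All terms decrease for 3k >= 2N + 11.  When
    N >= 80 the summand a^N dominates elsewhere: the coefficients of I increase
    for 3k <= 2N - 2 and form a concave sequence in between.  The remaining
    finitely many pairs (m, n) are settled by computation. *)

Local Open Scope ring_scope.

(** * Differences of the coefficients of (1 + 2t)^p *)

Definition pa : {poly int} := 1 + 2%:R *: 'X.
Definition pb : {poly int} := 1 + 'X.

(** The factor [1 - 'X] makes differences commute with multiplication by ['X^l]; at index 0 the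
    value is the coefficient itself. *)
Definition pdiff (k : nat) (f : {poly int}) : int := ((1 - 'X) * f)`_k.

Lemma pdiffD k : {morph pdiff k : f g / f + g}.
Proof. by move=> f g; rewrite /pdiff mulrDr coefD. Qed.

Lemma pdiff0 f : pdiff 0 f = f`_0.
Proof. by rewrite /pdiff mulrBl mul1r coefB coefXM subr0. Qed.

Lemma pdiffS k f : pdiff k.+1 f = f`_k.+1 - f`_k.
Proof. by rewrite /pdiff mulrBl mul1r coefB coefXM. Qed.

Lemma pdiffXnM l k f : pdiff k ('X^l * f) = if (k < l)%N then 0 else pdiff (k - l) f.
Proof. by rewrite /pdiff mulrCA coefXnM. Qed.

Lemma coef_pa p k : (pa ^+ p)`_k = ((2 ^ k * 'C(p, k))%N)%:Z.
Proof.
rewrite /pa exprDn coef_sum.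
under eq_bigr => i _ do rewrite expr1n mul1r exprZn coefMn coefZ coefXn.
have [kp|pk] := ltnP k p.+1; last first.
  rewrite bin_small // muln0 big1 // => i _; case: eqP => [ki|_]; last by rewrite mulr0 mul0rn.
  by have := ltn_ord i; lia.
rewrite (bigD1 (Ordinal kp)) //= eqxx big1 ?addr0 => [|i /eqP ik].
  by rewrite mulr1 -natrX -mulrnA; lia.
by case: eqP => [ki|_]; [case: ik; apply: val_inj|rewrite mulr0 mul0rn].
Qed.

Lemma mul_bin_step p j :
  (j.+1%:Z * 'C(p, j.+1)%:Z = (p%:Z - j%:Z) * 'C(p, j)%:Z)%R.
Proof.
have [jp|pj] := leqP j p; last by rewrite !bin_small //; lia.
by have := congr1 Posz (mul_bin_left p j); rewrite !PoszM -subzn.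
Qed.

Lemma pdiff_pa p K :
  K.+1%:Z * pdiff K.+1 (pa ^+ p)
  = (2 ^ K * 'C(p, K))%N%:Z * (2 * p%:Z - 3 * K%:Z - 1).
Proof.
rewrite pdiffS !coef_pa expnS !PoszM.
have := mul_bin_step p K; set u := 'C(p, K.+1); set v := 'C(p, K) => h.
transitivity ((2 ^ K)%:Z * (2 * (K.+1%:Z * u%:Z) - K.+1%:Z * v%:Z)); first by ring.
by rewrite h; lia.
Qed.

(** With y = 2p - 3(K+1) the last factor is y^2 - (3(K+1) + 4), negative for small |y|: this is
    concavity near the mode. *)
Lemma pdiff2_pa p K :
  K.+1%:Z * K.+2%:Z * (pdiff K.+2 (pa ^+ p) - pdiff K.+1 (pa ^+ p))
  = (2 ^ K * 'C(p, K))%N%:Z *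
    ((2 * p%:Z - 3 * K.+1%:Z) ^+ 2 - 3 * K.+1%:Z - 4).
Proof.
rewrite !pdiffS !coef_pa !expnS !PoszM.
have := mul_bin_step p K; have := mul_bin_step p K.+1.
set w := 'C(p, K.+2); set u := 'C(p, K.+1); set v := 'C(p, K) => h1 h2.
transitivity ((2 ^ K)%:Z * (4 * (K.+1%:Z * (K.+2%:Z * w%:Z))
   - 4 * (K.+2%:Z * (K.+1%:Z * u%:Z)) + K.+1%:Z * K.+2%:Z * v%:Z)); first by ring.
rewrite h1 [_ * (_ * u%:Z)]mulrCA !h2.
have -> : K.+2%:Z = K%:Z + 2 by lia.
have -> : K.+1%:Z = K%:Z + 1 by lia.
ring.
Qed.

(* Induction on [j], from 2 a^i b^(j+1) = a^(i+1) b^j + a^i b^j. *)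
Lemma le_additive_papb (L : {poly int} -> int) (B : int) N i j :
  {morph L : f g / f + g} ->
  (forall p, (p <= N)%N -> L (pa ^+ p) <= B) -> (i + j <= N)%N ->
  L (pa ^+ i * pb ^+ j) <= B.
Proof.
move=> LD LB; elim: j i => [|j IH] i le_N; first by rewrite mulr1; apply: LB; lia.
have: L (pa ^+ i * pb ^+ j.+1) + L (pa ^+ i * pb ^+ j.+1)
    = L (pa ^+ i.+1 * pb ^+ j) + L (pa ^+ i * pb ^+ j).
  by rewrite -!LD; congr (L _); rewrite !exprS /pa /pb -mul_polyC; ring.
have := IH i.+1; have := IH i; lia.
Qed.

Lemma double_bin q j : (q.+1 <= j.*2)%N -> (2 * 'C(q, j) <= 'C(q.+1, j))%N.
Proof.
case: j => [|j] h //; rewrite binS mul2n -addnn leq_add2l.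
have := mul_bin_left q j; have [qj|jq] := leqP q j; first by rewrite bin_small //; lia.
nia.
Qed.

(** Right of the middle, each raise of the upper index at least doubles the coefficient; this gain
    offsets polynomial factors later. *)
Lemma exp2_bin p e j : (p + e <= j.*2)%N -> (2 ^ e * 'C(p, j) <= 'C(p + e, j))%N.
Proof.
elim: e => [|e IH] h; first by rewrite mul1n addn0.
have := @double_bin (p + e) j; rewrite addnS expnS; have := IH; lia.
Qed.

(** Equality at [e = 0] fixes the constant 24; each step adds 14 on the left and at least 32 on the
    right. *)
Lemma linear_le_exp2 e : (7 * (4 + e) * 2 <= 2 ^ (4 + e).+1 + 24)%N.
Proof. by elim: e => [|e IH] //; rewrite addnS [(2 ^ _.+2)%N]expnS; lia. Qed.

(* The index [K.+1] is [k - l] for a term t^l a^p, and the constant 7 is the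
   number of such terms against which a^N has to compete. *)
Lemma bin_increment N p k K :
  (80 <= N)%N -> (3 * k + 2 <= 2 * N)%N -> (K.+2 <= k <= K + 4)%N -> (p <= N)%N ->
  7 * k%:Z * 'C(p, K)%:Z * (3 * K%:Z + 1 - 2 * p%:Z)
  <= K.+1%:Z * 'C(N, K)%:Z * (2 * N%:Z + 2 - 3 * k%:Z).
Proof.
move=> N80 kN Kk pN.
have [pK|Kp] := ltnP p K; first by rewrite (bin_small pK); nia.
have le1 := leq_bin2l K pN.
have [x0|x0] := leP (3 * K%:Z + 1 - 2 * p%:Z) 0; first by nia.
(* For [K < 9] the excess 3K + 1 - 2p is at most K + 1, so [N >= 80] and ['C(p, K) <= 'C(N, K)]
   suffice. *)
have [K9|K9] := ltnP K 9.
  have: 7 * k%:Z * (3 * K%:Z + 1 - 2 * p%:Z) <= K.+1%:Z * (2 * N%:Z + 2 - 3 * k%:Z) by nia.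
  nia.
(* [e] counts doublings: 2p + 2e <= 3K + 9 is at most 4K since [K >= 9], and at most 2N + 1 since K
   + 2 <= k. *)
pose x := (3 * K + 1 - 2 * p)%N; pose e := ((8 + x) %/ 2)%N.
have e4 : (4 <= e)%N by rewrite /e; lia.
have xe : (7 + x <= 2 * e)%N by rewrite /e; lia.
have eQ : (2 * e <= 8 + x)%N by rewrite /e; lia.
have h1 : (2 ^ e * 'C(p, K) <= 'C(p + e, K))%N by apply: exp2_bin; lia.
have h2 : ('C(p + e, K) <= 'C(N, K))%N by apply: leq_bin2l; lia.
have h3 : (7 * x <= 2 * 2 ^ e)%N by have := linear_le_exp2 (e - 4); rewrite subnKC // expnS; lia.
have h4 : (7 * x * 'C(p, K) <= 2 * 'C(N, K))%N.
  by rewrite (leq_trans (leq_mul h3 (leqnn _))) // -mulnA leq_mul2l /=; lia.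
have -> : 3 * K%:Z + 1 - 2 * p%:Z = x%:Z by lia.
(* Here k <= K + 4 <= 2(K+1), and 2N + 2 - 3k >= 4 absorbs both factors 2. *)
have : (7 * x * 'C(p, K) * k <= 2 * 'C(N, K) * (2 * K.+1))%N by apply: leq_mul => //; lia.
nia.
Qed.

(** * The independence polynomial for large N *)

(** Independence polynomial of a spider: a leg contributes 1 + 2t if the centre is not selected, 1 +
    t if it is. *)
Definition spider (n : nat) : {poly int} := pa ^+ n + 'X * pb ^+ n.

Definition ipoly (m n : nat) : {poly int} :=
  spider 3 * spider m * spider n + 'X * pa ^+ (3 + m + n).

(** Expanding the three spiders gives a^N and seven terms t^l a^i b^j; t a^N stays separate so that
    its own sign can be used. *)
Lemma le_additive_ipoly (L : {poly int} -> int) (B : int) m n :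
  {morph L : f g / f + g} ->
  (forall l p, (0 < l <= 3)%N -> (p <= 3 + m + n)%N -> L ('X^l * pa ^+ p) <= B) ->
  L (ipoly m n) <= L (pa ^+ (3 + m + n)) + L ('X * pa ^+ (3 + m + n)) + 7 * B.
Proof.
move=> LD LB.
have LBb l i j : (0 < l <= 3)%N -> (i + j <= 3 + m + n)%N ->
    L ('X^l * (pa ^+ i * pb ^+ j)) <= B.
  move=> l3; apply: (@le_additive_papb (fun f => L ('X^l * f))) => [f g|p pN].
    by rewrite mulrDr LD.
  exact: LB.
have -> : ipoly m n = pa ^+ (3 + m + n) + 'X * pa ^+ (3 + m + n)
  + 'X^1 * (pa ^+ (m + n) * pb ^+ 3) + 'X^1 * (pa ^+ (3 + n) * pb ^+ m)
  + 'X^1 * (pa ^+ (3 + m) * pb ^+ n) + 'X^2 * (pa ^+ n * pb ^+ (3 + m))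
  + 'X^2 * (pa ^+ m * pb ^+ (3 + n)) + 'X^2 * (pa ^+ 3 * pb ^+ (m + n))
  + 'X^3 * (pa ^+ 0 * pb ^+ (3 + m + n)).
  rewrite /ipoly /spider !exprD; ring.
rewrite !LD.
have := LBb 1%N (m + n)%N 3%N isT; have := LBb 1%N (3 + n)%N m isT.
have := LBb 1%N (3 + m)%N n isT; have := LBb 2%N n (3 + m)%N isT.
have := LBb 2%N m (3 + n)%N isT; have := LBb 2%N 3%N (m + n)%N isT.
have := LBb 3%N 0%N (3 + m + n)%N isT; lia.
Qed.

Lemma pdiff_pa_le0 p k : (2 * p + 2 <= 3 * k)%N -> pdiff k (pa ^+ p) <= 0.
Proof.
case: k => [|K] h; first by lia.
by rewrite -(pmulr_rle0 _ (ltr0Sn _ K)) (_ : K.+1%:R = K.+1%:Z) ?pdiff_pa; nia.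
Qed.

(** The constant 11 is 2 + 9: a shift by t^l with l <= 3 costs at most 9 in 3k. *)
Lemma pdiff_ipoly_le0 m n k :
  (2 * (3 + m + n) + 11 <= 3 * k)%N -> pdiff k (ipoly m n) <= 0.
Proof.
set N := (3 + m + n)%N => h.
have hl l p : (l <= 3)%N -> (p <= N)%N -> pdiff k ('X^l * pa ^+ p) <= 0.
  by move=> l3 pN; rewrite pdiffXnM; case: ifP => // _; apply: pdiff_pa_le0; lia.
have /= := @le_additive_ipoly (pdiff k) 0 m n (pdiffD k).
have := hl 0%N N isT; have := hl 1%N N isT; rewrite mul1r -/N => h1 h2 /(_ _)/le_trans->//.
  by move=> l p /andP[_ l3]; apply: hl.
have := h2 (leqnn _); have := h1 (leqnn _); rewrite expr1; lia.
Qed.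

Lemma coef_pa_le N j k : (j <= k)%N -> (3 * k <= 2 * N + 2)%N ->
  (pa ^+ N)`_j <= (pa ^+ N)`_k.
Proof.
elim: k => [|k IH] jk kN; first by have -> : j = 0%N by lia.
move: jk; rewrite leq_eqVlt => /orP[/eqP->//|jk].
apply: (le_trans (IH _ _)); [lia|lia|].
have := pdiff_pa N k; rewrite pdiffS; nia.
Qed.

(** For k > 0, k times the increment of a^N is its coefficient at k - 1 times 2N + 2 - 3k. Each of
    the seven terms loses at most a seventh of this, and t a^N does not decrease. *)
Lemma pdiff_ipoly_ge0 m n k : (80 <= 3 + m + n)%N ->
  (3 * k + 2 <= 2 * (3 + m + n))%N -> 0 <= pdiff k (ipoly m n).
Proof.
case: k => [|k].
  move=> _ _; rewrite pdiff0 /ipoly /spider /pa /pb.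
  rewrite -!horner_coef0 !(hornerE, horner_exp); lia.
set N := (3 + m + n)%N => N80 h.
set X := (pa ^+ N)`_k; pose c := 2 * N%:Z + 2 - 3 * k.+1%:Z.
have X0 : 0 <= X by rewrite /X coef_pa.
have c0 : 0 <= c by rewrite /c; lia.
(* The sign turns a lower bound into an upper bound; the factor 7(k+1) avoids fractions. *)
have LD : {morph (fun f => - (7 * k.+1%:Z * pdiff k.+1 f)) : f g / f + g}.
  by move=> f g; rewrite pdiffD; ring.
have LB l p : (0 < l <= 3)%N -> (p <= N)%N ->
    - (7 * k.+1%:Z * pdiff k.+1 ('X^l * pa ^+ p)) <= c * X.
  move=> l3 pN; rewrite pdiffXnM; case: ifP => [_|lk]; first by nia.
  case E: (k.+1 - l)%N => [|K]; first by rewrite pdiff0 coef_pa; nia.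
  have bi := @bin_increment N p k.+1 K N80 h _ pN.
  have {bi} := bi ltac:(lia); rewrite -/c => bi.
  have XK : (pa ^+ N)`_K <= X by apply: coef_pa_le; lia.
  have := pdiff_pa p K; set d := pdiff _ _; rewrite coef_pa in XK; clearbody c X d => dE.
  have K0 : 0 < K.+1%:Z by [].
  rewrite -(ler_pM2l K0).
  have -> : K.+1%:Z * - (7 * k.+1%:Z * d) = - (7 * k.+1%:Z * (K.+1%:Z * d)) by ring.
  rewrite dE.
  apply: (@le_trans _ _ (K.+1%:Z * c * ((2 ^ K)%:Z * 'C(N, K)%:Z))); last first.
    by rewrite -mulrA ler_pM2l // ler_wpM2l // -PoszM.
  have : 0 <= (2 ^ K)%:Z :> int by [].
  move: bi; rewrite PoszM; set u := (2 ^ K)%:Z => bi u0; clearbody u.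
  have := ler_wpM2l u0 bi; lia.
have := le_additive_ipoly LD LB; rewrite -/N.
have := pdiff_pa N k; rewrite -coef_pa -/X => e1.
have e2 : 0 <= pdiff k.+1 ('X * pa ^+ N).
  have := pdiffXnM 1 k.+1 (pa ^+ N); rewrite /= expr1 subSS subn0 => ->.
  case: k {e1 LD LB c c0 X X0} h => [|k] h; first by rewrite pdiff0 coef_pa.
  by have := pdiff_pa N k; nia.
set d := pdiff k.+1 (ipoly m n).
have -> : - (7 * k.+1%:Z * pdiff k.+1 (pa ^+ N)) = - (7 * (k.+1%:Z * pdiff k.+1 (pa ^+ N))) by ring.
rewrite e1; set e := pdiff _ ('X * _) in e2 *.
have -> : 2 * N%:Z - 3 * k%:Z - 1 = c by rewrite /c; lia.
have : 0 <= k.+1%:Z * e by rewrite mulr_ge0.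
move=> e3 h3.
have : 0 <= k.+1%:Z * d by lia.
by rewrite pmulr_rge0.
Qed.

(** In [pdiff2_ipoly_le0], d = N - p; the left side is (y - 2d)^2 + y at y = -7, the worst y for d
    >= 1, and 164 = 2 * 80 + 4. *)
Lemma sqr_le_exp2 d : (4 * d * d + 28 * d + 42 <= 164 + 5 * 2 ^ d)%N.
Proof.
case: d => [|[|[|[|d]]]] //; elim: d => [|d IH] //.
move: IH; rewrite [(2 ^ d.+1.+4)%N]expnS.
have : (d < 2 ^ d)%N by apply: ltn_expl.
by rewrite !expnS; nia.
Qed.

(* 729/1000 = (9/10)^3: consecutive coefficients near the mode lose at most a
   factor 9/10. *)
Lemma coef_pa_window N j k : (49 <= j)%N -> (3 * k <= 2 * N + 7)%N ->
  (j <= k <= j + 3)%N -> 729 * (pa ^+ N)`_j <= 1000 * (pa ^+ N)`_k.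
Proof.
move=> j49 kN.
(* The claim amounts to 9(i+1) <= 20(N - i); as 3i <= 2N + 4, the right side is at least 10(i - 4),
   whence the bound 49. *)
have step i : (49 <= i)%N -> (i < k)%N -> 9 * (pa ^+ N)`_i <= 10 * (pa ^+ N)`_i.+1.
  move=> i49 ik; have K0 : 0 < i.+1%:Z by [].
  rewrite -(ler_pM2l K0) !coef_pa expnS !PoszM.
  have -> : i.+1%:Z * (10 * (2%:Z * (2 ^ i)%:Z * 'C(N, i.+1)%:Z))
    = 20 * (2 ^ i)%:Z * (i.+1%:Z * 'C(N, i.+1)%:Z) by ring.
  rewrite mul_bin_step.
  have -> : i.+1%:Z * (9 * ((2 ^ i)%:Z * 'C(N, i)%:Z)) = (2 ^ i)%:Z * 'C(N, i)%:Z * (9 * i.+1%:Z) by ring.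
  have -> : 20 * (2 ^ i)%:Z * ((N%:Z - i%:Z) * 'C(N, i)%:Z) = (2 ^ i)%:Z * 'C(N, i)%:Z * (20 * (N%:Z - i%:Z)) by ring.
  by apply: ler_wpM2l; lia.
have c0 i : 0 <= (pa ^+ N)`_i by rewrite coef_pa.
move=> /andP[jk kj].
have := step j; have := step j.+1; have := step j.+2.
have := c0 j; have := c0 j.+1; have := c0 j.+2; have := c0 j.+3.
have kE : k = j \/ k = j.+1 \/ k = j.+2 \/ k = j.+3 by lia.
by case: kE => [|[|[|]]] ->; lia.
Qed.

(** After clearing denominators, a^N contributes at most -74X and each of the eight other terms at
    most 8X, where X is the coefficient of a^N at k - 1. *)
Lemma pdiff2_ipoly_le0 m n k : (80 <= 3 + m + n)%N ->
  (2 * (3 + m + n) <= 3 * k + 1)%N -> (3 * k <= 2 * (3 + m + n) + 10)%N ->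
  pdiff k.+1 (ipoly m n) <= pdiff k (ipoly m n).
Proof.
case: k => [|k]; first by lia.
set N := (3 + m + n)%N => N80 h1 h2.
set X := (pa ^+ N)`_k.
have X0 : 0 <= X by rewrite /X coef_pa.
pose L f := k.+1%:Z * k.+2%:Z * (pdiff k.+2 f - pdiff k.+1 f).
have LD : {morph L : f g / f + g}.
  by move=> f g; rewrite /L !pdiffD; ring.
(* 8 exceeds 5 * (1000/729) * (8/7), factors due to [sqr_le_exp2], to [coef_pa_window] and to
   changing the denominators from [K] to [k]. Since k >= 52, [K] is at least 49. *)
have LB l p : (0 < l <= 3)%N -> (p <= N)%N -> L ('X^l * pa ^+ p) <= 8 * X.
  move=> l3 pN; rewrite /L !pdiffXnM !ifF; try lia.
  have [K E] : exists K, (k.+1 - l = K.+1)%N by exists (k - l)%N; lia.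
  rewrite (_ : (k.+2 - l = K.+2)%N) ?E; last by lia.
  have := pdiff2_pa p K; set d := _ - _ => dE.
  have XK : 729 * (pa ^+ N)`_K <= 1000 * X by apply: coef_pa_window; lia.
  have [d0|d0] := leP d 0; first by nia.
  have bin2 : (2 ^ (N - p) * 'C(p, K) <= 'C(N, K))%N.
    by rewrite -{2}(subnKC pN); apply: exp2_bin; lia.
  have sq : (2 * p%:Z - 3 * K.+1%:Z) ^+ 2 - 3 * K.+1%:Z - 4 <= 5 * (2 ^ (N - p))%:Z.
    have := sqr_le_exp2 (N - p).
    (* The window for [k] and 1 <= l <= 3 confine y to [-7, 10], so y^2 <= 3y + 70. *)
    pose y := 2 * N%:Z - 3 * K.+1%:Z.
    have -> : 2 * p%:Z - 3 * K.+1%:Z = y - 2 * (N - p)%:Z by rewrite /y; lia.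
    have yl : -7 <= y by rewrite /y; lia.
    have yu : y <= 10 by rewrite /y; lia.
    have -> : 3 * K.+1%:Z = 2 * N%:Z - y by rewrite /y; lia.
    move: (N - p)%N (2 ^ _)%N => e t; clearbody y; rewrite expr2 => et.
    have := mulr_ge0 (_ : 0 <= y + 7) (_ : 0 <= 10 - y) => /(_ ltac:(lia) ltac:(lia)).
    by case: e et => [|e] et; nia.
  have dX : K.+1%:Z * K.+2%:Z * d <= 5 * (pa ^+ N)`_K.
    rewrite dE coef_pa !PoszM.
    have t0 : 0 <= (2 ^ K)%:Z :> int by [].
    have : 'C(p, K)%:Z * ((2 * p%:Z - 3 * K.+1%:Z) ^+ 2 - 3 * K.+1%:Z - 4) <= 5 * 'C(N, K)%:Z.
      apply: (@le_trans _ _ ('C(p, K)%:Z * (5 * (2 ^ (N - p))%:Z))); last by lia.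
      by apply: ler_wpM2l.
    by move/(ler_wpM2l t0); lia.
  have kK : 7 * (k.+1%:Z * k.+2%:Z) <= 8 * (K.+1%:Z * K.+2%:Z) by nia.
  have {kK} := ler_wpM2r (ltW d0) kK.
  by rewrite -!mulrA ![_ * d]mulrC !mulrA in dX *; lia.
have := le_additive_ipoly LD LB; rewrite -/N.
have := pdiff2_pa N k; rewrite -coef_pa -/X => e1.
have := LB 1%N N isT (leqnn _); rewrite expr1 => e2.
have {e1} : L (pa ^+ N) <= - 74 * X.
  rewrite /L e1.
  (* For y in [-10, 1], y^2 + y is at most 90, while 2N + 4 is at least 164; the difference is
     74. *)
  have : 74 <= 3 * k.+1%:Z + 4 - (2 * N%:Z - 3 * k.+1%:Z) ^+ 2.
    pose y := 2 * N%:Z - 3 * k.+1%:Z.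
    have yl : -10 <= y by rewrite /y; lia.
    have yu : y <= 1 by rewrite /y; lia.
    have -> : 3 * k.+1%:Z = 2 * N%:Z - y by rewrite /y; lia.
    have -> : 2 * N%:Z - (2 * N%:Z - y) = y by ring.
    by clearbody y; nia.
  set z := _ ^+ 2; nia.
move=> e1 e3.
have : L (ipoly m n) <= 0 by lia.
by rewrite /L pmulr_rle0 // subr_le0.
Qed.

(** * From the signs of differences to unimodality *)

Definition unimodal_fun (s : nat -> int) : Prop :=
  exists j, (forall i, (i < j)%N -> s i <= s i.+1) /\
            (forall i, (j <= i)%N -> s i.+1 <= s i).

(** The peak is the first index from [k0] on without a strict increase; [k1] ensures that it exists,
    and the second hypothesis carries the descent on. *)
Lemma unimodal_fun_diff (s : nat -> int) k0 k1 :
  (forall i, (i < k0)%N -> s i <= s i.+1) ->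
  (forall i, (k0 <= i)%N -> s i.+1 <= s i -> s i.+2 <= s i.+1) ->
  (k0 <= k1)%N -> s k1.+1 <= s k1 ->
  unimodal_fun s.
Proof.
move=> inc pers k01 dec.
have ex : exists i, (k0 <= i)%N && (s i.+1 <= s i) by exists k1; rewrite k01.
case: (ex_minnP ex) => j /andP[kj sj] minj; exists j; split=> i ij.
  have [/inc//|ki] := ltnP i k0.
  by apply/ltW; rewrite ltNge; apply: contraL ij => si; rewrite -leqNgt minj ?ki.
rewrite -(subnKC ij); elim: (i - j)%N => [|e IH]; first by rewrite addn0.
by rewrite addnS; apply: pers => //; lia.
Qed.

Lemma unimodal_ipoly_large m n : (80 <= 3 + m + n)%N ->
  unimodal_fun (fun k => (ipoly m n)`_k).
Proof.
set N := (3 + m + n)%N => N80.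
apply: (@unimodal_fun_diff _ ((2 * N - 2) %/ 3)%N (2 * N)%N).
- move=> i ik; rewrite -subr_ge0 -pdiffS; apply: pdiff_ipoly_ge0 => //.
  by rewrite -/N; lia.
- move=> i ik; rewrite -subr_le0 -pdiffS => d0; rewrite -subr_le0 -pdiffS.
  (* Far out every increment is nonpositive; before that, concavity passes the sign on. *)
  have [h|h] := leqP (2 * N + 11)%N (3 * i.+2); first exact: pdiff_ipoly_le0.
  by apply: le_trans d0; apply: pdiff2_ipoly_le0; rewrite -/N; lia.
- by lia.
- by rewrite -subr_le0 -pdiffS; apply: pdiff_ipoly_le0; rewrite -/N; lia.
Qed.

(** * The independence polynomial for small N *)

Section BinaryLists.

Implicit Types (x y : N) (s t f g p q : seq N).

Fixpoint lpoly s : {poly int} :=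
  if s is x :: s' then (N.to_nat x)%:Z%:P + 'X * lpoly s' else 0.

Fixpoint ladd s t : seq N :=
  match s, t with
  | x :: s', y :: t' => N.add x y :: ladd s' t'
  | [::], _ => t
  | _, [::] => s
  end.

Definition lshift s : seq N := N0 :: s.
Definition lmulb s := ladd s (lshift s).
Definition lmula s := ladd s (lshift (ladd s s)).

Fixpoint ldec x s : bool :=
  if s is y :: s' then if N.leb y x then ldec y s' else false else true.

Fixpoint lunimodal x s : bool :=
  if s is y :: s' then if N.leb x y then lunimodal y s' else ldec y s' else true.

(* [f] and [g] stand for F a^i and G b^i, so that a step to the next tree of a
   row, I(m, n) = F a^n + G b^n, costs only additions. *)
Fixpoint lrow c f g : bool :=
  if c is c'.+1 then
    if lunimodal N0 (ladd f g) then lrow c' (lmula f) (lmulb g) else false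
  else true.

(** For [p] = a^m and [q] = b^m, [u] is spider 3 times spider m, and I = (u + t a^(m+3)) a^n + t u
    b^n. *)
Definition lstart p q : seq N * seq N :=
  let s := ladd p (lshift q) in
  let u := ladd (lmula (lmula (lmula s))) (lshift (lmulb (lmulb (lmulb s)))) in
  (ladd u (lshift (lmula (lmula (lmula p)))), lshift u).

Fixpoint lrows c d p q : bool :=
  if c is c'.+1 then
    let: (f, g) := lstart p q in
    if lrow d f g then lrows c' d.-1 (lmula p) (lmulb q) else false
  else true.

Lemma coef_lpoly s i : (lpoly s)`_i = (N.to_nat (nth N0 s i))%:Z.
Proof.
elim: s i => [|x s IH] [|i] //=; rewrite ?coef0 ?coefD ?coefC ?coefXM //= ?addr0 //.
by rewrite add0r IH.
Qed.

Lemma lpoly_add s t : lpoly (ladd s t) = lpoly s + lpoly t.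
Proof.
elim: s t => [|x s IH] [|y t] /=; rewrite ?add0r ?addr0 //.
by rewrite N2Nat.inj_add PoszD polyCD IH; ring.
Qed.

Lemma lpoly_shift s : lpoly (lshift s) = 'X * lpoly s.
Proof. by rewrite /= add0r. Qed.

Lemma lpoly_mulb s : lpoly (lmulb s) = lpoly s * pb.
Proof. by rewrite lpoly_add lpoly_shift /pb; ring. Qed.

Lemma lpoly_mula s : lpoly (lmula s) = lpoly s * pa.
Proof. by rewrite lpoly_add lpoly_shift lpoly_add /pa -mul_polyC; ring. Qed.

Lemma leb_to_nat x y : N.leb x y -> (N.to_nat x <= N.to_nat y)%N.
Proof. by move=> /N.leb_le; lia. Qed.

Lemma ldecP x s : ldec x s ->
  forall i, (lpoly (x :: s))`_i.+1 <= (lpoly (x :: s))`_i.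
Proof.
elim: s x => [|y s IH] x; first by move=> _ [|i]; rewrite !coef_lpoly //= nth_nil.
rewrite [ldec _ _]/=; case: ifP => // yx ds [|i].
  by rewrite !coef_lpoly /= lez_nat leb_to_nat.
by have := IH y ds i; rewrite !coef_lpoly.
Qed.

Lemma lunimodal_cons x s : lunimodal x s -> unimodal_fun (fun i => (lpoly (x :: s))`_i).
Proof.
elim: s x => [|y s IH] x; first by move=> _; exists 0%N; split=> // i _; apply: ldecP.
rewrite [lunimodal _ _]/=; case: ifP => [xy|/negbT xy] us.
  have [j [inc dec]] := IH y us; exists j.+1; split=> [[|i] ij|[//|i] ij].
  - by rewrite !coef_lpoly /= lez_nat leb_to_nat.
  - by have := inc i ij; rewrite !coef_lpoly.
  - by have := dec i ij; rewrite !coef_lpoly.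
exists 0%N; split=> // i _; apply: ldecP => /=; case: ifP => // /negbT yx.
by move: xy yx; case: (N.leb_spec x y); case: (N.leb_spec y x) => //; lia.
Qed.

Lemma lunimodalP s : lunimodal N0 s -> unimodal_fun (fun i => (lpoly s)`_i).
Proof.
move=> /lunimodal_cons[j [inc dec]]; exists j.-1; split=> i ij.
  by have := inc i.+1; rewrite !coef_lpoly; apply; lia.
by have := dec i.+1; rewrite !coef_lpoly; apply; lia.
Qed.

Lemma lrowP c f g : lrow c f g -> forall i, (i < c)%N ->
  unimodal_fun (fun k => (lpoly f * pa ^+ i + lpoly g * pb ^+ i)`_k).
Proof.
elim: c f g => [|c IH] f g //=; case: ifP => // /lunimodalP ufg ur [|i] ic.
  by rewrite !mulr1 -lpoly_add.
by have := IH _ _ ur i ic; rewrite lpoly_mula lpoly_mulb !exprS !mulrA.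
Qed.

Lemma lrowsP c d p q m0 : lpoly p = pa ^+ m0 -> lpoly q = pb ^+ m0 ->
  lrows c d p q -> forall m n, (m < c)%N -> (m + n < d)%N ->
  unimodal_fun (fun k => (ipoly (m0 + m) n)`_k).
Proof.
elim: c d p q m0 => [|c IH] d p q m0 pE qE //.
rewrite [lrows _ _ _ _]/=; case: ifP => // /lrowP ur urs [|m] n mc nd.
  have -> : ipoly (m0 + 0) n
    = lpoly (lstart p q).1 * pa ^+ n + lpoly (lstart p q).2 * pb ^+ n; last exact: ur.
  rewrite /lstart !(lpoly_shift, lpoly_add, lpoly_mula, lpoly_mulb) pE qE addn0.
  by rewrite /ipoly /spider !exprD; ring.
rewrite -addSnnS; apply: (IH d.-1 _ _ _ _ _ urs) => //; last by lia.
  by rewrite lpoly_mula pE exprSr.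
by rewrite lpoly_mulb qE exprSr.
Qed.

End BinaryLists.

(** N < 80 means m + n < 77, and with m <= n this gives m < 39. *)
Lemma lrows_small : lrows 39 77 [:: Npos xH] [:: Npos xH].
Proof. by vm_compute. Qed.

Lemma ipolyC m n : ipoly m n = ipoly n m.
Proof. by rewrite /ipoly -!addnA [(n + m)%N]addnC mulrAC. Qed.

Lemma unimodal_ipoly m n : unimodal_fun (fun k => (ipoly m n)`_k).
Proof.
wlog mn : m n / (m <= n)%N.
  by move=> W; case/orP: (leq_total m n) => /W //; rewrite ipolyC.
have [big|small] := leqP 80 (3 + m + n)%N; first exact: unimodal_ipoly_large.
have one : lpoly [:: Npos xH] = 1 by rewrite /= mulr0 addr0.
by have := lrowsP (m0 := 0) one one lrows_small (m := m) (n := n); apply; lia.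
Qed.

(** * Independent sets of the tree *)

Definition indep_poly (T : finType) (adj : rel T) : {poly int} :=
  \sum_(S : {set T} | independent adj S) 'X^#|S|.

Lemma coef_indep_poly (T : finType) (adj : rel T) k :
  (indep_poly adj)`_k = (indep_count adj k)%:Z.
Proof.
rewrite coef_sum /indep_count -sum1dep_card -[RHS]natz natr_sum [RHS]big_mkcondr.
by apply: eq_bigr => S _; rewrite coefXn eq_sym; case: eqP.
Qed.

Section SumSets.

Variables T1 T2 : finType.

Definition join_set (S1 : {set T1}) (S2 : {set T2}) : {set T1 + T2} :=
  [set x | match x with inl y => y \in S1 | inr z => z \in S2 end].

Lemma card_join_set S1 S2 : #|join_set S1 S2| = (#|S1| + #|S2|)%N.
Proof.
rewrite -!sum1_card big_mkcond big_sumType /=.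
by congr addn; rewrite [RHS]big_mkcond; apply: eq_bigr => x _; rewrite inE.
Qed.

Lemma sum_join_set (V : nmodType) (phi : {set T1 + T2} -> V) :
  \sum_S phi S = \sum_S1 \sum_S2 phi (join_set S1 S2).
Proof.
rewrite pair_bigA /= (reindex (fun S => join_set S.1 S.2)) //=.
exists (fun S : {set T1 + T2} => ([set x | inl x \in S], [set x | inr x \in S])) => [[S1 S2]|S] _ /=.
  by congr pair; apply/setP=> x; rewrite !inE.
by apply/setP=> -[x|x]; rewrite !inE.
Qed.

End SumSets.

Section Legs.

Variable J : finType.

Definition leg_set (f : {ffun J -> bool * bool}) : {set J * bool} :=
  [set x | if x.2 then (f x.1).2 else (f x.1).1].

Lemma card_leg_set f : #|leg_set f| = (\sum_j ((f j).1 + (f j).2))%N.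
Proof.
transitivity (\sum_j \sum_b (if (j, b) \in leg_set f then 1 else 0))%N.
  by rewrite pair_bigA /= -sum1_card big_mkcond; apply: eq_bigr => -[j b].
apply: eq_bigr => j _; rewrite big_bool !inE /= addnC.
by case: (f j) => [[] []].
Qed.

(* [c] tells whether the vertex carrying the legs is selected. *)
Definition legs_ok (c : bool) (L : {set J * bool}) : bool :=
  [forall j, ~~ (((j, false) \in L) && (c || ((j, true) \in L)))].

(** The legs are chosen independently, so the sum factors; when the vertex carrying a leg is
    selected, only the leaf of that leg remains available. *)
Lemma sum_legs c :
  \sum_(L | legs_ok c L) 'X^#|L| = (if c then pb else pa) ^+ #|J|.
Proof.
pose F (u : bool * bool) : {poly int} :=
  if u.1 && (c || u.2) then 0 else 'X^(u.1 + u.2).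
transitivity (\prod_(j : J) \sum_u F u); last first.
  rewrite prodr_const; congr (_ ^+ _).
  rewrite -(pair_bigA _ (fun a b => F (a, b))) /= !big_bool /F {F} /=.
  by case: c => /=; rewrite /pa /pb -?mul_polyC; ring.
rewrite bigA_distr_bigA big_mkcond /= (reindex leg_set) /=; last first.
  exists (fun L : {set J * bool} => [ffun j => ((j, false) \in L, (j, true) \in L)]) => [f|L] _.
    by apply/ffunP=> j; rewrite ffunE !inE /=; case: (f j).
  by apply/setP=> -[j []]; rewrite !inE ffunE.
apply: eq_bigr => f _; case: ifP => [/forallP ok|/forallPn[j]].
  rewrite card_leg_set expr_sum; apply: eq_bigr => j _.
  by have := ok j; rewrite !inE /F /= => /negbTE ->.
by rewrite negbK !inE /= => bad; rewrite (bigD1 j) //= /F bad mul0r.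
Qed.

End Legs.

Lemma independentP (T : finType) (adj : rel T) (S : {set T}) :
  reflect {in S &, forall x y, ~~ adj x y} (independent adj S).
Proof.
apply: (iffP forall_inP) => [h x y xS yS|h x xS]; first exact: (forall_inP (h x xS)).
by apply/forall_inP=> y yS; apply: h.
Qed.

(** Removing all legs at [c] leaves a weight that depends only on whether [c] is selected. The
    factor [phi] carries the weights of legs removed earlier, so the lemma can be iterated. *)
Lemma sum_indep_legs (T J : finType) (adj : rel (T + J * bool)) (c : T)
    (phi : {set T} -> {poly int}) :
  symmetric adj ->
  (forall x j b, adj (inl x) (inr (j, b)) = (x == c) && ~~ b) ->
  (forall j b j' b', adj (inr (j, b)) (inr (j', b')) = (j == j') && (b != b')) ->
  \sum_(S | independent adj S) 'X^#|S| * phi [set x | inl x \in S]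
  = \sum_(S | independent (relpre inl adj) S)
      'X^#|S| * ((if c \in S then pb else pa) ^+ #|J| * phi S).
Proof.
move=> adjC adj_lr adj_rr.
rewrite big_mkcond sum_join_set [RHS]big_mkcond; apply: eq_bigr => S1 _.
have indep S2 : independent adj (join_set S1 S2)
    = independent (relpre inl adj) S1 && legs_ok (c \in S1) S2.
  apply/independentP/andP => [h|[/independentP h1 /forallP h2]].
    split; first by apply/independentP=> x y xS yS; apply: (h (inl x) (inl y)); rewrite inE.
    apply/forallP=> j; apply/negP=> /andP[jf /orP[cS|jt]].
      by have := h (inl c) (inr (j, false)); rewrite !inE adj_lr eqxx => /(_ cS jf).
    by have := h (inr (j, false)) (inr (j, true)); rewrite !inE adj_rr eqxx => /(_ jf jt).
  have lr x j b : x \in S1 -> (j, b) \in S2 -> ~~ adj (inl x) (inr (j, b)).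
    move=> xS jS; rewrite adj_lr; apply/negP=> /andP[/eqP xc /negbTE b0].
    by have := h2 j; rewrite -xc xS -b0 jS.
  move=> [x|[j b]] [y|[j' b']]; rewrite !inE => xS yS.
  - exact: h1.
  - exact: lr.
  - by rewrite adjC; apply: lr.
  - rewrite adj_rr; apply/negP=> /andP[/eqP jj bb]; move: (h2 j); rewrite -jj in yS.
    by case: b b' bb xS yS => [] [] // _ -> ->; rewrite orbT.
case: (boolP (independent _ S1)) => i1; last first.
  by rewrite big1 // => S2 _; rewrite indep (negbTE i1).
rewrite mulrA -sum_legs mulr_sumr mulr_suml [RHS]big_mkcond.
apply: eq_bigr => S2 _; rewrite indep i1 /=; case: ifP => // _.
rewrite card_join_set exprD; congr (_ * phi _).
by apply/setP=> x; rewrite !inE.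
Qed.

(** Without legs a star remains. Selecting its root excludes all other vertices; otherwise they are
    chosen freely. *)
Lemma sum_indep_star (I : finType) (adj : rel (unit + I)) (g : I -> bool -> {poly int}) :
  symmetric adj -> ~~ adj (inl tt) (inl tt) ->
  (forall i, adj (inl tt) (inr i)) ->
  (forall i j, ~~ adj (inr i) (inr j)) ->
  \sum_(S | independent adj S) 'X^#|S| * \prod_i g i (inr i \in S)
  = \prod_i (g i false + 'X * g i true) + 'X * \prod_i g i false.
Proof.
move=> adjC adj_ll adj_lr adj_rr.
pose h (e : bool) i u : {poly int} := if e && u then 0 else 'X^u * g i u.
rewrite big_mkcond sum_join_set.
transitivity (\sum_(e : bool) 'X^e * \prod_i \sum_(u : bool) h e i u); last first.
  rewrite big_bool /= addrC expr1 mul1r; congr (_ + 'X * _).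
    by apply: eq_bigr => i _; rewrite big_bool /h /= expr0 expr1; ring.
  by apply: eq_bigr => i _; rewrite big_bool /h /= expr0; ring.
rewrite (reindex (fun e : bool => if e then [set tt] else set0)) /=; last first.
  exists (fun S : {set unit} => tt \in S) => [[]|S] _; rewrite ?inE //.
  by apply/setP=> -[]; case: (boolP (tt \in S)) => tS; rewrite !inE.
apply: eq_bigr => e _; rewrite bigA_distr_bigA mulr_sumr.
rewrite (reindex (fun f : {ffun I -> bool} => [set i | f i])) /=; last first.
  exists (fun S : {set I} => [ffun i => i \in S]) => [f|S] _.
    by apply/ffunP=> i; rewrite ffunE inE.
  by apply/setP=> i; rewrite inE ffunE.
apply: eq_bigr => f _.
have tS : (tt \in (if e then [set tt] else set0)) = e by case: e; rewrite inE.
case: ifP => [/independentP ind|/negbT nind].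
  rewrite card_join_set exprD -mulrA; congr (_ * _); first by case: (e); rewrite ?cards1 ?cards0.
  rewrite -sum1dep_card expr_sum big_mkcond -big_split /=.
  apply: eq_bigr => i _; rewrite inE inE /h.
  case: (boolP (e && f i)) => [/andP[e1 fi]|_]; last by case: (f i).
  by have := ind (inl tt) (inr i); rewrite !inE tS e1 fi adj_lr => /(_ isT isT).
case: (boolP (e && [exists i, f i])) => [/andP[e1 /existsP[i fi]]|none].
  by rewrite (bigD1 i) //= /h e1 fi mul0r mulr0.
case/negP: nind; apply/independentP=> -[[]|i] [[]|j]; rewrite ?inE ?tS //.
- move=> e1 fj; case/negP: none; rewrite e1; apply/existsP; by exists j.
- move=> fi e1; case/negP: none; rewrite e1; apply/existsP; by exists i.
Qed.

(** As [c] lies outside the legs, only a leaf and its own neighbour are adjacent within them. This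
    serves all three groups of legs. *)
Lemma leg_parent_adj (T J : finType) (x : J * bool -> T) (p : T -> option T) (c : T) :
  injective x -> (forall u, x u != c) ->
  (forall j b, p (x (j, b)) = Some (if b then x (j, false) else c)) ->
  forall j b j' b',
  (p (x (j, b)) == Some (x (j', b'))) || (p (x (j', b')) == Some (x (j, b)))
  = (j == j') && (b != b').
Proof.
move=> xI xc px j b j' b'; rewrite !px !(inj_eq Some_inj).
have cx u : (c == x u) = false by rewrite eq_sym (negbTE (xc u)).
by case: b b' => [] []; rewrite ?cx ?(inj_eq xI) ?xpair_eqE ?andbF ?andbT ?orbF //= eq_sym.
Qed.

(** The legs at v3, v2, v1 are stripped in this order, the outermost summand of [tvert] first, until
    the star at v0 remains. *)
Lemma indep_poly_tadj m n : indep_poly (@tadj m n) = ipoly m n.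
Proof.
have symm : symmetric (@tadj m n) by move=> x y; rewrite /tadj orbC.
pose w k b : {poly int} := (if b then pb else pa) ^+ k.
pose adj2 : rel (unit + 'I_3 + 'I_3 * bool + 'I_m * bool) := relpre inl (@tadj m n).
pose adj1 : rel (unit + 'I_3 + 'I_3 * bool) := relpre inl adj2.
pose adj0 : rel (unit + 'I_3) := relpre inl adj1.
transitivity (\sum_(S | independent (@tadj m n) S) ('X^#|S| * 1 : {poly int})).
  by apply: eq_bigr => S _; rewrite mulr1.
apply: etrans (sum_indep_legs (c := inl (inl (inr c2))) (fun _ => 1) symm _ _) _.
- move=> [[[[]|i]|[j []]]|[j []]] j' []; rewrite ?andbF ?andbT //=.
- apply: (@leg_parent_adj _ _ inr (@tparent m n) (inl (inl (inl (inr c2))))) => //.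
    by move=> ? ? [].
  by move=> j [].
transitivity (\sum_(S | independent adj2 S)
   'X^#|S| * w n (inl (inr c2) \in [set x | inl x \in S])).
  by apply: eq_bigr => S _; rewrite mulr1 inE card_ord.
apply: etrans (sum_indep_legs (c := inl (inr c1)) (fun S => w n (inl (inr c2) \in S)) _ _ _) _.
- by move=> x y; apply: symm.
- move=> [[[]|i]|[j []]] j' []; rewrite ?andbF ?andbT //=.
- apply: (@leg_parent_adj _ _ (fun u => inl (inr u)) (@tparent m n) (inl (inl (inl (inr c1))))) => //.
    by move=> ? ? [].
  by move=> j [].
transitivity (\sum_(S | independent adj1 S) 'X^#|S| *
   (w m (inr c1 \in [set x | inl x \in S]) * w n (inr c2 \in [set x | inl x \in S]))).
  by apply: eq_bigr => S _; rewrite !inE card_ord.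
apply: etrans (sum_indep_legs (c := inr c0)
  (fun S => w m (inr c1 \in S) * w n (inr c2 \in S)) _ _ _) _.
- by move=> x y; apply: symm.
- move=> [[]|i] j' []; rewrite ?andbF ?andbT //=.
- apply: (@leg_parent_adj _ _ (fun u => inl (inl (inr u))) (@tparent m n) (inl (inl (inl (inr c0))))) => //.
    by move=> ? ? [].
  by move=> j [].
pose g (i : 'I_3) := w (nth 0 [:: 3; m; n] i)%N.
transitivity (\sum_(S | independent adj0 S) 'X^#|S| * \prod_i g i (inr i \in S)).
  apply: eq_bigr => S _; rewrite card_ord !big_ord_recl big_ord0 mulr1.
  have -> : lift ord0 (lift ord0 ord0) = c2 :> 'I_3 by apply: val_inj.
  have -> : lift ord0 ord0 = c1 :> 'I_3 by apply: val_inj.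
  by have -> : ord0 = c0 :> 'I_3 by apply: val_inj.
rewrite sum_indep_star //; last by move=> x y; apply: symm.
by rewrite !big_ord_recl !big_ord0 /g /w /= /ipoly /spider !exprD; ring.
Qed.

Local Close Scope ring_scope.
Unset Implicit Arguments.

Theorem mainTheorem1 (m n : nat) (hm : 1 <= m) (hn : 1 <= n) :
  unimodal (indep_poly_coefs (@tadj m n)).
Proof.
have [j [inc dec]] := unimodal_ipoly m n; exists j.
have nthE i : i < size (indep_poly_coefs (@tadj m n)) ->
    nth 0 (indep_poly_coefs (@tadj m n)) i = indep_count (@tadj m n) i.
  rewrite size_map size_iota => iN.
  by rewrite (nth_map 0) ?size_iota // nth_iota.
split=> i ij iN; rewrite !nthE ?(ltnW iN) // -lez_nat -!coef_indep_poly indep_poly_tadj.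
  exact: inc.
exact: dec.
Qed.
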